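(* Let $(X,d,A)$ be a metric pair with $A\neq\varnothing$ such that $(X/A,\overline d_1,[A])$ is uniformly discrete, let $\psi:[0,\infty)\to[0,\infty)$ satisfy $\psi(0)=0$ and $\sum_{x,y\in X\setminus A,\,x\ne y}\psi(\overline d_1(x,y))<\infty$, and let $H$, $(p_t)_{t\ge0}$, $\rho$ be as in the context. Let $t>0$ and $\alpha>0$, and let $A_t(\alpha)=\{h\in H:p_t(h)\ge\alpha\}$. There exists $\varepsilon_0>0$ such that for every $\varepsilon\in(0,\varepsilon_0)$, $$N\bigl(A_t(\alpha),\varepsilon\bigr)\le\min\left\{\frac1\alpha,\frac{\mathbb P(X_t=X_t')}{\alpha^2}\right\}=\min\left\{\frac1\alpha,\frac1{\alpha^2}\sum_{h\in H}p_t(h)^2\right\},$$ where $X_t$ has law $p_t$ (the random walk with convolution semigroup $(p_t)$ started at the origin) and $X_t'$ is an independent copy of $X_t$ started at the origin.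
   Context: Metric pair: $(X,d)$ is a metric space and $A\subseteq X$ is nonempty. Put $d(x,A)=\inf_{a\in A}d(x,a)$ and $d_1(x,y)=\min(d(x,y),d(x,A)+d(y,A))$. $X/A$ is the quotient collapsing $A$ to a basepoint $[A]$, and $\overline d_1$ is the metric on $X/A$ induced by $d_1$ (so $\overline d_1(x,y)=d_1(x,y)$ and $\overline d_1(x,[A])=d(x,A)$ for $x,y\in X\setminus A$). Uniformly discrete means: there is $c>0$ with $\overline d_1(u,v)\ge c$ for all distinct $u,v\in X/A$. $D(X,A)$ is the free commutative monoid on $X$ modulo the submonoid generated by $A$ (finite multisets in $X\setminus A$); $K(X,A)$ is its Grothendieck group, identified with $\bigoplus_{x\in X\setminus A}\mathbb Z e_x$ and regarded as a discrete abelian group. For $\alpha,\beta\in D(X,A)$, $W_1(\alpha,\beta)$ is the infimum of $\sum_i\overline d_1(u_i,v_i)$ over finite families of pairs $(u_i,v_i)\in (X/A)^2$ such that $\alpha$ is the multiset of those $u_i\neq[A]$ and $\beta$ the multiset of those $v_i\ne[A]$. The metric $\rho$ on $K(X,A)$ is $\rho(\alpha-\beta,\gamma-\delta)=W_1(\alpha+\delta,\gamma+\beta)$; it is translation invariant. For $S\subset K(X,A)$ and $\varepsilon>0$, the covering number $N(S,\varepsilon)$ is the smallest integer $m$ such that $S$ can be covered by $m$ open $\rho$-balls of radius $\varepsilon$. For $\theta$ in the dual group $\widehat{K(X,A)}$ put $\lambda^\psi(\theta)=\frac12\sum_{x,y\in X\setminus A,\,x\neq y}\psi(\overline d_1(x,y))(1-\Re\,\theta(e_x-e_y))$;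 $(p_t)_{t\ge0}=(p_t^\psi)_{t\ge0}$ is the unique convolution semigroup of probability measures on $K(X,A)$ with $\sum_gp_t(g)\overline{\theta(g)}=e^{-t\lambda^\psi(\theta)}$. With $\operatorname{supp}(p)=\{g:p(g)>0\}$, $H$ is the subgroup generated by $\bigcup_{q\in\mathbb Q_{\ge0}}\operatorname{supp}(p_q)$; it is countable and contains every $\operatorname{supp}(p_t)$, so $p_t$ is regarded as a probability measure on $H$. *)

(* Defs.v *)
Set Warnings "-notation-overridden,-ambiguous-paths,-notation-incompatible-prefix".
From HB Require Import structures.
From mathcomp Require Export all_boot all_order all_algebra finmap.
From mathcomp Require Export multiset freeg complex.
From mathcomp Require Export all_classical all_reals all_analysis.
From mathcomp Require Export summability.
From mathcomp Require Import zify lra.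

Set Implicit Arguments.
Unset Strict Implicit.
Unset Printing Implicit Defensive.

Export Order.TTheory GRing.Theory Num.Theory numFieldNormedType.Exports.
Local Open Scope classical_set_scope.
Local Open Scope ring_scope.
Local Open Scope complex_scope.

Section MetricPair.
Context {R : realType} {X : metricType R}.
Implicit Types (A : set X) (psi : R -> R).

(* X \ A, as a type. *)
Definition offset A : choiceType := set_type (~` A).

(* X/A for nonempty A: [Some x] is the class of x outside A, [None] is [A]. *)
Definition quot A : choiceType := option (offset A).

(* D(X,A) and K(X,A), identified with the finite multisets in X \ A and with
   the free abelian group on X \ A. *)
Definition Dgrp A : choiceType := {mset offset A}%mset.
Definition Kgrp A : zmodType := {freeg (offset A)}.

Definition dist_set A (x : X) : R := inf [set mdist x a | a in A].

Definition d1 A (x y : X) : R :=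
  Order.min (mdist x y) (dist_set A x + dist_set A y).

Definition dbar1 A (u v : quot A) : R :=
  match u, v with
  | Some x, Some y => d1 A (val x) (val y)
  | Some x, None => dist_set A (val x)
  | None, Some y => dist_set A (val y)
  | None, None => 0
  end.

Definition uniformly_discrete A : Prop :=
  exists2 c : R, 0 < c & forall u v : quot A, u != v -> c <= dbar1 u v.

(* The pairs (u_i, v_i) are listed by s; [pmap id] drops the entries [A]. *)
Definition is_matching A (a b : Dgrp A) (s : seq (quot A * quot A)) : Prop :=
  a = seq_mset (pmap id (unzip1 s)) /\ b = seq_mset (pmap id (unzip2 s)).

Definition W1 A (a b : Dgrp A) : R :=
  inf [set \sum_(uv <- s) dbar1 uv.1 uv.2 | s in is_matching a b].

Definition e_ A (x : offset A) : Kgrp A := << x >>.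

Definition mset_to_K A (a : Dgrp A) : Kgrp A := \sum_(x <- enum_mset a) e_ x.

Definition pos_part A (g : Kgrp A) : Dgrp A :=
  [fsfun x in [fset y in dom g]%fset => `|Order.max 0%R (coeff x g)|%N].
Definition neg_part A (g : Kgrp A) : Dgrp A := pos_part (- g).

(* The value on g = a - b and h = c - d does not depend on the representatives
   (see rho_sub below), so we take g = g^+ - g^- and h = h^+ - h^-. *)
Definition rho A (g h : Kgrp A) : R :=
  W1 (pos_part g `+` neg_part h)%mset (pos_part h `+` neg_part g)%mset.

Definition covered_by A (S : set (Kgrp A)) (eps : R) (m : nat) : Prop :=
  exists c : 'I_m -> Kgrp A,
    S `<=` \bigcup_(i in [set: 'I_m]) [set g | rho (c i) g < eps].

(* +oo if no finite cover exists. *)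
Definition covering_number A (S : set (Kgrp A)) (eps : R) : \bar R :=
  ereal_inf [set m%:R%:E | m in covered_by S eps].

(* K(X,A) is discrete, so every homomorphism to the circle is in the dual. *)
Definition in_dual A (theta : Kgrp A -> R[i]) : Prop :=
  (forall g, `|theta g| = 1) /\
  (forall g h, theta (g + h) = theta g * theta h).

Definition off_diag A : set (offset A * offset A) := [set xy | xy.1 != xy.2].
Arguments off_diag : clear implicits.

Definition psi_dbar1 A psi (xy : offset A * offset A) : R :=
  psi (dbar1 (Some xy.1 : quot A) (Some xy.2 : quot A)).

Definition lambda A psi (theta : Kgrp A -> R[i]) : R :=
  2^-1 * fine (\esum_(xy in off_diag A)
    (psi_dbar1 psi xy * (1 - complex.Re (theta (e_ xy.1 - e_ xy.2))))%:E).

(* Probability measures on the discrete group K(X,A) are given by their mass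
   functions; vague continuity at 0 is then pointwise convergence. *)
Record convolution_semigroup A (p : R -> Kgrp A -> R) : Prop := {
  cs_ge0 : forall t g, 0 <= t -> 0 <= p t g;
  cs_sum1 : forall t, 0 <= t -> (\esum_(g in [set: Kgrp A]) (p t g)%:E = 1)%E;
  cs_zero : forall g, p 0 g = (g == 0)%:R;
  cs_add : forall s t g, 0 <= s -> 0 <= t ->
    ((p (s + t) g)%:E = \esum_(h in [set: Kgrp A]) (p s h * p t (g - h))%:E)%E;
  cs_cont : forall g, p t g @[t --> 0^'+] --> ((g == 0)%:R : R)
}.

(* The sum over K(X,A) is the limit of the finite partial sums along the
   directed set of finite subsets; R[i]^o carries the topology of C. *)
Definition has_exponent A psi (p : R -> Kgrp A -> R) : Prop :=
  forall t theta, 0 <= t -> in_dual theta ->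
    partial_sum (fun g => (p t g)%:C * (theta g)^* : R[i]^o) @ totally -->
      ((expR (- (t * lambda psi theta)))%:C : R[i]^o).

Definition supp A (q : Kgrp A -> R) : set (Kgrp A) := [set g | 0 < q g].

Definition is_subgroup A (G : set (Kgrp A)) : Prop :=
  G 0 /\ forall g h, G g -> G h -> G (g - h).

Definition Hgrp A (p : R -> Kgrp A -> R) : set (Kgrp A) :=
  smallest (@is_subgroup A)
    (\bigcup_(q in [set q : rat | 0 <= q]) supp (p (ratr q))).

Definition super_level A (H : set (Kgrp A)) (q : Kgrp A -> R) (alpha : R) :=
  [set h | H h /\ alpha <= q h].

(* Random elements of the countable discrete group H: every subset of H is
   measurable. *)
Definition has_law A (H : set (Kgrp A)) (d : measure_display)
    (Omega : measurableType d) (P : probability Omega R)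
    (Y : Omega -> set_type H) (q : Kgrp A -> R) : Prop :=
  forall S : set (set_type H), measurable (Y @^-1` S) /\
    (P (Y @^-1` S) = \esum_(h in S) (q (val h))%:E)%E.

Definition independent A (H : set (Kgrp A)) (d : measure_display)
    (Omega : measurableType d) (P : probability Omega R)
    (Y Y' : Omega -> set_type H) : Prop :=
  forall S S' : set (set_type H),
    (P (Y @^-1` S `&` Y' @^-1` S') = P (Y @^-1` S) * P (Y' @^-1` S'))%E.

Lemma dist_set_ge0 A x : 0 <= dist_set A x.
Proof.
have [[a Aa]|A0] := pselect (A !=set0).
  by apply: lb_le_inf; [exists (mdist x a), a|move=> _ [b _ <-]; exact: mdist_ge0].
by rewrite /dist_set (_ : A = set0) ?image_set0 ?inf0//; apply/nonemptyPn.
Qed.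

Lemma dist_set_le A x a : A a -> dist_set A x <= mdist x a.
Proof.
move=> Aa; apply: ge_inf; last by exists a.
by exists 0 => _ [b _ <-]; exact: mdist_ge0.
Qed.

Lemma dist_set_triangle A x y : dist_set A x <= mdist x y + dist_set A y.
Proof.
have [[a Aa]|A0] := pselect (A !=set0); last first.
  have -> : A = set0 by apply/nonemptyPn.
  by rewrite /dist_set !image_set0 inf0 addr0 mdist_ge0.
rewrite -lerBlDl; apply: lb_le_inf; first by exists (mdist y a), a.
move=> _ [b Ab <-]; rewrite lerBlDl.
exact: le_trans (dist_set_le _ Ab) (metric_triangle _ _ _).
Qed.

Lemma dbar1_ge0 A (u v : quot A) : 0 <= dbar1 u v.
Proof.
case: u v => [x|] [y|] //=; rewrite ?dist_set_ge0// /d1.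
by rewrite le_min mdist_ge0 addr_ge0 ?dist_set_ge0.
Qed.

Lemma dbar1_refl A (u : quot A) : dbar1 u u = 0.
Proof.
case: u => [x|] //=; rewrite /d1 mdistxx; apply/min_idPl.
by rewrite addr_ge0 ?dist_set_ge0.
Qed.

Lemma dbar1_triangle A (v u w : quot A) : dbar1 u w <= dbar1 u v + dbar1 v w.
Proof.
have tri := dist_set_triangle A; have ge0 := dist_set_ge0 A.
case: u v w => [x|] [y|] [z|] //=; rewrite ?add0r ?addr0 ?ge0 ?addr_ge0 ?ge0//.
- have := metric_triangle (val x) (val y) (val z).
  have := tri (val x) (val y); have := tri (val z) (val y).
  rewrite (metric_sym (val z)) /d1; have := ge0 (val y).
  have m1 (a b : R) : Order.min a b <= a by rewrite ge_min lexx.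
  have m2 (a b : R) : Order.min a b <= b by rewrite ge_min lexx orbT.
  have := m1 (mdist (val x) (val z)) (dist_set A (val x) + dist_set A (val z)).
  have := m2 (mdist (val x) (val z)) (dist_set A (val x) + dist_set A (val z)).
  case: (leP (mdist (val x) (val y)) _) => ?;
    by case: (leP (mdist (val y) (val z)) _) => ? *; lra.
- have := tri (val x) (val y); have := ge0 (val y); rewrite /d1.
  by case: (leP (mdist _ _) _) => *; lra.
- by rewrite /d1 ge_min lexx orbT.
- have := tri (val z) (val y); rewrite (metric_sym (val z)); have := ge0 (val y).
  by rewrite /d1; case: (leP (mdist _ _) _) => *; lra.
Qed.

Lemma is_matchingP A (a b : Dgrp A) s : is_matching a b s <->
  forall x, a x = count_mem (Some x) (unzip1 s) /\
            b x = count_mem (Some x) (unzip2 s).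
Proof.
have E (r : seq (quot A)) x :
    seq_mset (pmap id r) x = count_mem (Some x) r.
  rewrite mset_seqE; elim: r => //= -[y|] r <- //=.
split=> [[-> ->] x|H]; first by rewrite !E.
by split; apply/msetP => x; rewrite E; case: (H x).
Qed.

Lemma ex_matching A (a b : Dgrp A) : exists s, is_matching a b s.
Proof.
exists ([seq (Some x, None) | x <- enum_mset a] ++
        [seq (None, Some x) | x <- enum_mset b]).
apply/is_matchingP => x; rewrite /unzip1 /unzip2 !map_cat !count_cat -!map_comp.
have cS (r : seq (offset A)) : count_mem (Some x) (map Some r) = count_mem x r.
  by elim: r => //= y r ->.
have cN (r : seq (offset A)) :
    count_mem (Some x) (map (fun=> None) r : seq (quot A)) = 0%N.
  by elim: r.
by split; rewrite ?cS ?cN ?addn0 -count_mem_mset.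
Qed.

Lemma W1_le A (a b : Dgrp A) s : is_matching a b s ->
  W1 a b <= \sum_(uv <- s) dbar1 uv.1 uv.2.
Proof.
move=> m; apply: ge_inf; last by exists s.
by exists 0 => _ [r _ <-]; apply: sumr_ge0 => uv _; exact: dbar1_ge0.
Qed.

Lemma le_W1 A (a b : Dgrp A) r :
  (forall s, is_matching a b s -> r <= \sum_(uv <- s) dbar1 uv.1 uv.2) ->
  r <= W1 a b.
Proof.
move=> H; apply: lb_le_inf; last by move=> _ [s m <-]; exact: H.
by have [s m] := ex_matching a b; exists (\sum_(uv <- s) dbar1 uv.1 uv.2), s.
Qed.

Lemma W1_add1 A (x : offset A) (a b : Dgrp A) :
  W1 (x +` a)%mset (x +` b)%mset = W1 a b.
Proof.
have cS y (r : seq (quot A)) :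
    count_mem (Some y) (Some x :: r) = ((y == x) + count_mem (Some y) r)%N.
  by rewrite /= -[y == x]/(Some y == Some x) eq_sym.
have pick (r : seq (quot A * quot A)) i : i \in r ->
    exists2 r', perm_eq r (i :: r') &
      \sum_(uv <- r) dbar1 uv.1 uv.2 =
      dbar1 i.1 i.2 + \sum_(uv <- r') dbar1 uv.1 uv.2.
  move=> ir; exists (rem i r); first exact: perm_to_rem.
  by rewrite (perm_big _ (perm_to_rem ir)) big_cons.
have cnt (f : quot A * quot A -> quot A) (r r' : seq (quot A * quot A)) y :
    perm_eq r r' -> count_mem y (map f r) = count_mem y (map f r').
  by move=> pr; apply/permP; exact: perm_map.
apply/eqP; rewrite eq_le; apply/andP; split; apply: le_W1 => s m.
  have mx : is_matching (x +` a)%mset (x +` b)%mset ((Some x, Some x) :: s).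
    apply/is_matchingP => y; have /is_matchingP/(_ y)[e1 e2] := m.
    by rewrite !mset1DE e1 e2 /unzip1 /unzip2 !map_cons !cS.
  by have := W1_le mx; rewrite big_cons [dbar1 _ _]dbar1_refl add0r.
have /is_matchingP ms := m.
have : Some x \in unzip1 s.
  by rewrite -has_pred1 has_count -(ms x).1 mset1DE eqxx.
move=> /mapP[[u v] uvs /= xu]; subst u.
have [s1 p1 ->] := pick _ _ uvs.
have c1 y := cnt (@fst _ _) _ _ (Some y) p1.
have c2 y := cnt (@snd _ _) _ _ (Some y) p1.
have ha y : a y = count_mem (Some y) (unzip1 s1).
  by apply: (@addnI (y == x)); rewrite -mset1DE (ms y).1 [LHS]c1 map_cons cS.
have [vx|vx] := eqVneq v (Some x).
  subst v; rewrite [dbar1 _ _]dbar1_refl add0r; apply/W1_le/is_matchingP => y; split=> //.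
  by apply: (@addnI (y == x)); rewrite -mset1DE (ms y).2 [LHS]c2 map_cons cS.
have : Some x \in unzip2 s1.
  have := (ms x).2; rewrite mset1DE eqxx [in X in _ = X -> _]c2/= (negbTE vx).
  by rewrite add0n => e; rewrite -has_pred1 has_count -e.
move=> /mapP[[u w] uws1 /= xw]; subst w.
have [s2 p2 ->] := pick _ _ uws1.
have c3 y := cnt (@fst _ _) _ _ (Some y) p2.
have c4 y := cnt (@snd _ _) _ _ (Some y) p2.
rewrite addrA.
apply: (@le_trans _ _ (\sum_(uv <- (u, v) :: s2) dbar1 uv.1 uv.2)).
  apply/W1_le/is_matchingP => y; split; first by rewrite ha [LHS]c3.
  apply: (@addnI (y == x)); rewrite -mset1DE (ms y).2 [LHS]c2 map_cons.
  rewrite [count_mem _ (_ :: _)]/= [count_mem _ (map snd s1)]c4 map_cons cS.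
  by rewrite addnCA.
by rewrite big_cons/= lerD2r addrC; exact: dbar1_triangle.
Qed.

Lemma W1_addr A (c a b : Dgrp A) :
  W1 (a `+` c)%mset (b `+` c)%mset = W1 a b.
Proof.
rewrite -[c]seq_mset_id; elim: (enum_mset c) => [|x s IHs].
  have e (q : Dgrp A) : (q `+` seq_mset [::])%mset = q.
    by apply/msetP => y; rewrite msetE2 mset_seqE addn0.
  by rewrite !e.
have e (q : Dgrp A) : (q `+` seq_mset (x :: s) = x +` (q `+` seq_mset s))%mset.
  apply/msetP => y; rewrite mset1DE !msetE2 !mset_seqE/= addnCA.
  by rewrite [x == y]eq_sym.
by rewrite !e W1_add1.
Qed.

Lemma coeff_mset_to_K A (a : Dgrp A) x : coeff x (mset_to_K a) = (a x)%:Z.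
Proof.
rewrite -count_mem_mset /mset_to_K; elim: (enum_mset a) => [|y s IHs].
  by rewrite big_nil coeff0.
by rewrite big_cons coeffD IHs coeffU mul1r /= PoszD; case: (y == x).
Qed.

Lemma pos_partE A (g : Kgrp A) x : pos_part g x = `|Order.max 0%R (coeff x g)|%N.
Proof. by rewrite fsfunE inE/=; case: ifPn => // /coeff_outdom ->. Qed.

Lemma neg_partE A (g : Kgrp A) x : neg_part g x = `|Order.max 0%R (- coeff x g)|%N.
Proof. by rewrite pos_partE coeffN. Qed.

Lemma pos_neg_partE A (g : Kgrp A) :
  g = mset_to_K (pos_part g) - mset_to_K (neg_part g).
Proof.
apply/eqP/freeg_eqP => x.
rewrite coeffB !coeff_mset_to_K pos_partE neg_partE; lia.
Qed.

Lemma rho_sub A (a b c d : Dgrp A) :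
  rho (mset_to_K a - mset_to_K b) (mset_to_K c - mset_to_K d) =
  W1 (a `+` d)%mset (c `+` b)%mset.
Proof.
set g := mset_to_K a - _; set h := mset_to_K c - _.
rewrite -(W1_addr (neg_part g `+` neg_part h)%mset) /rho.
rewrite -(W1_addr (b `+` d)%mset (_ `+` _)%mset).
have bal (i j : nat) :
    (`|Order.max 0%R (i%:Z - j%:Z)%R| + j =
     i + `|Order.max 0%R (- (i%:Z - j%:Z))%R|)%N.
  by rewrite opprB; case: (leqP i j) => ij; lia.
congr (W1 _ _); apply/msetP => x;
  rewrite !msetE2 !neg_partE !pos_partE /g /h !coeffB !coeff_mset_to_K.
  by rewrite addnACA bal [RHS]addnACA [(d x + _)%N]addnC.
rewrite [(b x + _)%N]addnC addnACA bal [X in _ = (_ + X)%N]addnC [RHS]addnACA.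
by rewrite [(b x + _)%N]addnC.
Qed.

End MetricPair.
Arguments off_diag {R X} A _.

(* Main.v *)
(* Every point lies in its own [rho]-ball, so for any radius the covering number
   is at most the cardinality of the super-level set, which Markov's inequality
   applied to [p_t] and to [p_t ^ 2] bounds by [1 / alpha] and by
   [(\sum p_t ^ 2) / alpha ^ 2].  Each [p_t] has countable support, hence [H] is
   countable and [X_t = X_t'] is a countable disjoint union of the events
   [X_t = X_t' = h], each of probability [p_t h ^ 2] by independence. *)
Require Import Defs.
From mathcomp Require Import all_boot all_order all_algebra all_classical all_reals all_analysis.

Import Order.TTheory GRing.Theory Num.Theory.
Local Open Scope classical_set_scope.
Local Open Scope ring_scope.

(** Markov's inequality for counting measure: the partial sum over [F] is one of those whose
    supremum is the [\esum]. Stating it for finite [F] lets it also prove that the super-level set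
    is finite. *)
Lemma card_super_level_le {R : realType} {T : choiceType} {D : set T}
    {q : T -> R} {alpha : R} {F : {fset T}} :
  [set` F] `<=` [set x | D x /\ alpha <= q x] ->
  ((#|` F|%:R * alpha)%:E <= \esum_(x in D) (q x)%:E)%E.
Proof.
move=> FD; apply: esum_ge; exists [set` F].
  by split; [exact: finite_fset|move=> x /FD[]].
rewrite fsbig_finite; last exact: finite_fset.
rewrite set_fsetK sumEFin lee_fin -sum1_size natr_sum mulr_suml.
rewrite big_seq [leRHS]big_seq; apply: ler_sum => x xF.
by rewrite mul1r; have [] := FD x xF.
Qed.

Lemma finite_super_level {R : realType} {T : choiceType} (D : set T)
    (q : T -> R) (alpha : R) :
  0 < alpha -> (\esum_(x in D) (q x)%:E < +oo)%E ->
  finite_set [set x | D x /\ alpha <= q x].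
Proof.
move=> alpha0 qD; apply: contrapT => inf.
have [r0|r0] := leP (\esum_(x in D) (q x)%:E)%E 0%E.
  have [F FD F1] := infinite_set_fset 1 inf.
  have := le_trans (card_super_level_le FD) r0.
  by rewrite lee_fin leNgt mulr_gt0// ltr0n.
have fn : (\esum_(x in D) (q x)%:E)%E \is a fin_num.
  by rewrite ge0_fin_numE// ltW.
set r := fine (\esum_(x in D) (q x)%:E)%E.
have r_ge0 : 0 <= r by rewrite fine_ge0// ltW.
(* More than [r / alpha] points of weight at least [alpha] would exceed the total [r]. *)
have [F FD Fn] := infinite_set_fset (Num.bound (r / alpha)) inf.
have := card_super_level_le FD.
rewrite -[X in (_ <= X)%E -> _](fineK fn) lee_fin -/r -ler_pdivlMr// leNgt.
move/negP; apply; have := archi_boundP (divr_ge0 r_ge0 (ltW alpha0)).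
by move/lt_le_trans; apply; rewrite ler_nat.
Qed.

(** The support is the union over [n] of the super-level sets at height [1 / (n + 1)], each of them
    finite. *)
Lemma countable_supp {R : realType} {T : choiceType} (q : T -> R) :
  (\esum_(x in [set: T]) (q x)%:E < +oo)%E -> countable [set x | 0 < q x].
Proof.
move=> qT.
apply: (@sub_countable _ _ _ (\bigcup_n [set x | setT x /\ n.+1%:R^-1 <= q x])).
  apply: subset_card_le => x /= qx; exists (Num.bound (q x)^-1) => //=.
  split=> //; rewrite -[leRHS]invrK lef_pV2 ?posrE ?invr_gt0 ?ltr0n//.
  apply: ltW; apply: lt_le_trans (archi_boundP _) _; first by rewrite invr_ge0 ltW.
  by rewrite ler_nat.
apply: bigcup_countable => // n _; apply: finite_set_countable.
by apply: finite_super_level => //; rewrite invr_gt0.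
Qed.

Section Covering.
Context {R : realType} {X : metricType R} {A : set X}.
Implicit Types (G : set (Kgrp A)) (p : R -> Kgrp A -> R).

Lemma rho_refl (g : Kgrp A) : rho g g = 0.
Proof.
apply/eqP; rewrite eq_le; apply/andP; split; last first.
  by apply: le_W1 => s _; apply: sumr_ge0 => uv _; exact: dbar1_ge0.
rewrite /rho; set a := (X in W1 X _).
(* The diagonal matching pairs every point with itself, at cost zero. *)
pose s := [seq (Some x : quot A, Some x : quot A) | x <- enum_mset a].
have m : is_matching a a s.
  have pK : pmap id [seq (Some x : quot A) | x <- enum_mset a] = enum_mset a.
    by elim: (enum_mset a) => //= x r ->.
  by rewrite /is_matching /s /unzip1 /unzip2 -!map_comp !pK seq_mset_id.
apply: le_trans (W1_le m) _; rewrite big_map big1// => x _.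
exact: dbar1_refl.
Qed.

Lemma covered_by_fset (F : {fset Kgrp A}) (eps : R) :
  0 < eps -> Defs.covered_by [set` F] eps #|` F|.
Proof.
move=> eps0; exists (fun i => nth 0 F i) => g gF.
have iF : (index g F < #|` F|)%N by rewrite index_mem.
by exists (Ordinal iF) => //=; rewrite nth_index// rho_refl.
Qed.

(** The values of finite signed words in the generators form a subgroup containing [G], and there
    are only countably many words. *)
Lemma countable_smallest_subgroup G :
  countable G -> countable (smallest (@is_subgroup R X A) G).
Proof.
move=> /countable_injP[f finj].
(* [e] decodes the numbering [f] of [G]; numbers that encode no generator go to 0. *)
pose e (n : nat) : Kgrp A :=
  if pselect (exists2 g, G g & f g = n) is left H then s2val (cid2 H) else 0.
have eG g : G g -> e (f g) = g.
  move=> Gg; rewrite /e; case: pselect => [H|]; last by case; exists g.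
  case: cid2 => /= h Gh fhg; apply: finj => //; exact: mem_set.
pose w (s : seq (bool * nat)) : Kgrp A :=
  \sum_(i <- s) (if i.1 then e i.2 else - e i.2).
apply: (@sub_countable _ _ _ (range w)); last first.
  exact: card_le_trans (card_image_le _ _) (countableP _).
apply: subset_card_le; apply: smallest_sub; last first.
  by move=> g Gg; exists [:: (true, f g)] => //; rewrite /w big_seq1/= eG.
split; first by exists [::] => //; rewrite /w big_nil.
move=> _ _ [s _ <-] [r _ <-].
(* Flipping all signs of [r] negates its value, so this word represents the difference. *)
exists (s ++ [seq (~~ i.1, i.2) | i <- r]) => //.
rewrite /w big_cat big_map /= -sumrN; congr (_ + _).
by apply: eq_bigr => -[[] n] _ //=; rewrite opprK.
Qed.

Lemma countable_Hgrp p : convolution_semigroup p -> countable (Hgrp p).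
Proof.
move=> hp; apply: countable_smallest_subgroup.
apply: bigcup_countable => //= q q0; apply: countable_supp.
by rewrite (cs_sum1 hp) ?ler0q// ltry.
Qed.

End Covering.

Lemma prob_eq_independent {R : realType} {X : metricType R} {A : set X}
    (H : set (Kgrp A)) (q : Kgrp A -> R) (d : measure_display)
    (Omega : measurableType d) (P : probability Omega R)
    (Y Y' : Omega -> set_type H) :
  countable H -> (forall h, H h -> 0 <= q h) ->
  has_law P Y q -> has_law P Y' q -> independent P Y Y' ->
  (P [set w | Y w = Y' w] = \esum_(h in H) (q h ^+ 2)%:E)%E.
Proof.
move=> /countable_injP[f finj] q0 lY lY' ind.
pose E h := Y @^-1` [set h] `&` Y' @^-1` [set h].
have mE h : measurable (E h).
  by apply: measurableI; [exact: (lY _).1|exact: (lY' _).1].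
have qv (h : set_type H) : (0 <= (q (val h))%:E)%E.
  by rewrite lee_fin q0//; exact: set_valP.
have PE h : P (E h) = (q (val h) ^+ 2)%:E.
  by rewrite /E ind (lY _).2 (lY' _).2 !esum_set1// -EFinM expr2.
pose fv (h : set_type H) := f (val h).
have fvinj : injective fv.
  by move=> h k /finj hk; apply: val_inj; apply: hk; apply: mem_set; exact: set_valP.
(* Relabels the events [E h] by natural numbers, as countable additivity requires; [B n] is empty
   off the range of [fv]. *)
pose B n := \bigcup_(h in [set h | fv h = n]) E h.
have Bfv h : B (fv h) = E h.
  by apply/seteqP; split=> w => [[k /= /fvinj ->]|Ew] //; exists h.
have -> : [set w | Y w = Y' w] = \bigcup_(n in range fv) B n.
  apply/seteqP; split=> w /=.
    by move=> YY'; exists (fv (Y w)); [exists (Y w)|rewrite Bfv /E/=].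
  by move=> [_ [h _ <-]]; rewrite Bfv => -[/= -> ->].
rewrite measure_bigcup; last 2 first.
- by move=> _ [h _ <-]; rewrite Bfv.
- move=> _ _ [h _ <-] [k _ <-]; rewrite !Bfv => -[w [[/= Yh _] [/= Yk _]]].
  by rewrite -Yh -Yk.
rewrite nneseries_esum//.
have -> : [set n | n \in range fv] = range fv.
  by apply/seteqP; split=> n; [exact: set_mem|exact: mem_set].
rewrite (@reindex_esum _ _ _ setT _ fv); last first.
  by apply: inj_bij => h k _ _; exact: fvinj.
rewrite [RHS](@reindex_esum _ _ _ [set: set_type H] _ val).
  by apply: eq_esum => h _; rewrite Bfv; exact: PE.
split=> [h _|h k _ _|h Hh]; [exact: set_valP|exact: val_inj|].
by exists (exist _ h (mem_set Hh)).
Qed.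

Theorem theorem17 (R : realType) (X : metricType R) (A : set X)
  (A0 : A !=set0) (hA : uniformly_discrete A)
  (psi : R -> R) (psi_ge0 : forall r, 0 <= r -> 0 <= psi r) (psi0 : psi 0 = 0)
  (psi_sum : (\esum_(xy in off_diag A) (psi_dbar1 psi xy)%:E < +oo)%E)
  (p : R -> Kgrp A -> R) (hp : convolution_semigroup p)
  (hpsi : has_exponent psi p)
  (t : R) (t_gt0 : 0 < t) (alpha : R) (alpha_gt0 : 0 < alpha) :
  exists2 eps0 : R, 0 < eps0 & forall eps : R, 0 < eps < eps0 ->
    (covering_number (super_level (Hgrp p) (p t) alpha) eps <=
       Order.min (alpha^-1)%:E
         ((alpha ^- 2)%:E * \esum_(h in Hgrp p) (p t h ^+ 2)%:E))%E
    /\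
    forall (d : measure_display) (Omega : measurableType d)
      (P : probability Omega R) (Xt Xt' : Omega -> set_type (Hgrp p)),
      has_law P Xt (p t) -> has_law P Xt' (p t) -> independent P Xt Xt' ->
      (Order.min (alpha^-1)%:E ((alpha ^- 2)%:E * P [set w | Xt w = Xt' w]) =
       Order.min (alpha^-1)%:E
         ((alpha ^- 2)%:E * \esum_(h in Hgrp p) (p t h ^+ 2)%:E))%E.
Proof.
(* The bound holds at every positive radius, so any positive [eps0] would do. *)
exists 1 => // eps /andP[eps_gt0 _].
have p_ge0 h : 0 <= p t h by apply: (cs_ge0 hp); exact: ltW.
split; last first.
  move=> d Omega P Xt Xt' lX lX' ind; rewrite (prob_eq_independent _ (p t))//.
  exact: countable_Hgrp.
have p1 : (\esum_(g in [set: Kgrp A]) (p t g)%:E = 1)%E.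
  by apply: (cs_sum1 hp); exact: ltW.
set S := super_level _ _ _.
have finS : finite_set S.
  apply: (@sub_finite_set _ _ [set g | setT g /\ alpha <= p t g]).
    by move=> g [].
  by apply: finite_super_level => //; rewrite p1 ltry.
have [F SF] : exists F : {fset Kgrp A}, S = [set` F] by exact/finite_fsetP.
apply: (@le_trans _ _ #|` F|%:R%:E).
  apply: ereal_inf_lbound; exists #|` F| => //.
  by rewrite SF; exact: covered_by_fset.
rewrite le_min; apply/andP; split.
  have : [set` F] `<=` [set g | setT g /\ alpha <= p t g].
    by rewrite -SF => g [].
  by move/card_super_level_le; rewrite p1 lee_fin -ler_pdivlMr// div1r.
(* Squaring preserves the order of nonnegative numbers, so Markov applies to [p t g ^+ 2] at height
   [alpha ^+ 2]. *)
have : [set` F] `<=` [set g | Hgrp p g /\ alpha ^+ 2 <= p t g ^+ 2].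
  rewrite -SF => g [Hg ag]; split=> //.
  by rewrite lerXn2r// ?nnegrE// ltW.
move/card_super_level_le => h.
by rewrite muleC lee_pdivlMr ?exprn_gt0// -EFinM.
Qed.
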